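(* Let $m\ge1$. The collection of all $B=(B,s_1^B,\ldots,s_m^B)\in\mathcal{F}_0$ satisfying conditions (1) every point in $B$ is outgoing for exactly one of $s_1^B,(s_1^{-1})^B,\ldots,s_m^B,(s_m^{-1})^B$, and (2) whenever $R$ is one of $s_1,\ldots,s_m$ and $R^B(x,y)$, then either $x$ is $R^B$-outgoing or $y$ is $R^B$-incoming, is coinitial in $\mathcal{F}_0$; that is, for every $A\in\mathcal{F}_0$ there are $B\in\mathcal{F}_0$ satisfying (1) and (2) and an epimorphism $\phi\colon B\to A$.
   Context: A relation $s^A\subseteq A^2$ on a set $A$ is surjective if for every $a\in A$ there are $b,c\in A$ with $s^A(a,b)$ and $s^A(c,a)$. For fixed $m\ge1$, $\mathcal{F}_0$ is the class of all structures $(A,s_1^A,\ldots,s_m^A)$ with $A$ a finite non-empty set and $s_1^A,\ldots,s_m^A$ surjective relations on $A$. A map $\phi\colon B\to A$ between such structures is an epimorphism if it is surjective and for each $i$ and all $x_1,x_2\in A$: $s_i^A(x_1,x_2)$ if and only if there are $y_1,y_2\in B$ with $\phi(y_1)=x_1$, $\phi(y_2)=x_2$ and $s_i^B(y_1,y_2)$. $(s_i^{-1})^B$ denotes the inverse relation of $s_i^B$, and $(s_i^{-1})^{-1}=s_i$. For $R$ one of $s_1,s_1^{-1},\ldots,s_m,s_m^{-1}$ and $x\in B$: $x$ is $R^B$-outgoing (outgoing for $R^B$) if there is more than one $z\in B$ with $R^B(x,z)$ and there is exactly one $y\in B$ with $R^B(y,x)$; $x$ is $R^B$-incoming if there is more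 than one $y\in B$ with $R^B(y,x)$ and there is exactly one $z\in B$ with $R^B(x,z)$. Thus $x$ is $R^B$-outgoing iff it is $(R^{-1})^B$-incoming. *)

(* Defs.v *)
From mathcomp Require Import all_boot.
Set Implicit Arguments.
Unset Strict Implicit.
Unset Printing Implicit Defensive.

Definition surjective_rel (T : Type) (r : rel T) : Prop :=
  forall a, (exists b, r a b) /\ (exists c, r c a).

Record F0 (m : nat) : Type := MkF0 {
  carrier :> finType;
  s : 'I_m -> rel carrier;
  carrier_gt0 : 0 < #|carrier|;
  s_surjective : forall i, surjective_rel (s i)
}.

Definition epimorphism (m : nat) (B A : F0 m) (phi : B -> A) : Prop :=
  (forall x : A, exists y : B, phi y = x) /\
  (forall (i : 'I_m) (x1 x2 : A),
     s i x1 x2 <->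
     exists y1 y2 : B, [/\ phi y1 = x1, phi y2 = x2 & s i y1 y2]).

Definition inv_rel (T : Type) (r : rel T) : rel T := fun x y => r y x.

(* The 2m formal symbols: [(i, false)] stands for s_i and [(i, true)] for its
   inverse. Distinct symbols count as distinct even if they happen to be
   interpreted by the same relation in a given structure. *)
Definition symbol (m : nat) : Type := ('I_m * bool)%type.

Definition interp (m : nat) (B : F0 m) (R : symbol m) : rel B :=
  if R.2 then inv_rel (s R.1) else s R.1.

Definition outgoing (T : finType) (r : rel T) (x : T) : bool :=
  (1 < #|[set z | r x z]|) && (#|[set y | r y x]| == 1).

Definition incoming (T : finType) (r : rel T) (x : T) : bool :=
  (1 < #|[set y | r y x]|) && (#|[set z | r x z]| == 1).

Definition outgoing_for_exactly_one (m : nat) (B : F0 m) : Prop :=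
  forall x : B, exists! R : symbol m, outgoing (interp R) x.

Definition edges_outgoing_or_incoming (m : nat) (B : F0 m) : Prop :=
  forall (i : 'I_m) (x y : B),
    s i x y -> outgoing (s i) x \/ incoming (s i) y.

Definition coinitial (m : nat) (P : F0 m -> Prop) : Prop :=
  forall A : F0 m, exists B : F0 m,
    P B /\ exists phi : B -> A, epimorphism phi.

(* Main.v *)
Require Import Defs.
From mathcomp Require Import all_boot.

(** Given [A], take for [B] the points of [A] labelled by a symbol [R] (the one
    for which the point is going to be outgoing) and by a bit, and let [phi]
    forget the labels.  Fix for every symbol [R] a function [succ R] on [A] that
    selects an [R]-successor, so that [succ] of the inverse symbol selects
    predecessors.  For a given [s_i] the points of [B] are sources (label
    [s_i]), sinks (label [s_i^-1]) or neutral (all others), and the [s_i]-edges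
    are drawn as follows:
    - from a source to a sink whenever [A] has an edge between their images;
    - into a point that is not a sink, only one edge, from the source with the
      same bit over its selected predecessor;
    - out of a point that is not a source, only one edge, to the sink with the
      same bit over its selected successor.
    The source-to-sink edges already cover every edge of [A], and the two values
    of the bit give each source two successors and each sink two predecessors.
    So a point has several successors when it is a source and one otherwise,
    several predecessors when it is a sink and one otherwise: sources are
    exactly the outgoing points, sinks exactly the incoming ones, and neutral
    points, with one edge on either side, are neither.  Every edge starts at a
    source or ends at a sink, as the condition on edges requires.

    Reversing all the arrows exchanges sources and sinks ([edge_inv]), hence
    only the successors have to be counted ([card_edge]). *)

Lemma eq_outgoing (T : finType) (r r' : rel T) x :
  r =2 r' -> outgoing r x = outgoing r' x.
Proof.
move=> rr'; rewrite /outgoing; congr ((1 < _) && (_ == 1)).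
  by apply: eq_card => y; rewrite !inE rr'.
by apply: eq_card => y; rewrite !inE rr'.
Qed.

Section Labelling.

Set Implicit Arguments.
Unset Strict Implicit.

Variables (m : nat) (A : F0 m).

Definition inv_symbol (R : symbol m) : symbol m := (R.1, ~~ R.2).

Lemma inv_symbolK : involutive inv_symbol.
Proof. by case=> i b; rewrite /inv_symbol /= negbK. Qed.

Lemma inv_symbol_neq R : (R == inv_symbol R) = false.
Proof. by case: R => i []; rewrite /inv_symbol xpair_eqE andbF. Qed.

Lemma interp_inv (B : F0 m) R (x y : B) :
  interp (inv_symbol R) x y = interp R y x.
Proof. by case: R => i []. Qed.

Lemma interp_serial R (a : A) : exists b, interp R a b.
Proof. by case: R => i []; case: (s_surjective i a). Qed.

Definition succ R (a : A) : A := xchoose (interp_serial R a).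

Lemma succP R a : interp R a (succ R a).
Proof. exact: xchooseP. Qed.

Definition labelled : finType := (A * symbol m * bool)%type.

Definition proj (x : labelled) : A := x.1.1.
Definition label (x : labelled) : symbol m := x.1.2.

(** Defined for every symbol, not only for the [s_i], so that the passage to the
    inverse symbol can reverse it. *)
Definition edge (R : symbol m) : rel labelled := fun x y =>
  if label x == R then
    if label y == inv_symbol R then interp R (proj x) (proj y)
    else (x.2 == y.2) && (proj x == succ (inv_symbol R) (proj y))
  else [&& label y == inv_symbol R, y.2 == x.2 & proj y == succ R (proj x)].

(** The two cases with exactly one special end, an [R]-source or an [R]-sink,
    are exchanged by the reversal, and the other two are invariant. *)
Lemma edge_inv R x y : edge (inv_symbol R) x y = edge R y x.
Proof.
rewrite /edge inv_symbolK interp_inv.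
by case: (label x == _); case: (label y == _).
Qed.

Lemma edge_proj R x y : edge R x y -> interp R (proj x) (proj y).
Proof.
rewrite /edge; case: ifP => _; first case: ifP => // _.
- by case/andP=> _ /eqP->; rewrite -interp_inv succP.
- by case/and3P=> _ _ /eqP->; apply: succP.
Qed.

Lemma edge_label R x y : edge R x y -> label x = R \/ label y = inv_symbol R.
Proof.
rewrite /edge; case: eqP => [|_]; first by left.
by case/andP=> /eqP; right.
Qed.

(** The edges of [A] lift with arbitrary bits at both ends; this is what makes
    the projection an epimorphism and gives sources two successors. *)
Lemma edge_lift R a b k l :
  edge R (a, R, k) (b, inv_symbol R, l) = interp R a b.
Proof. by rewrite /edge /label /= !eqxx. Qed.

Lemma edge_serial R x : exists y, edge R x y.
Proof.
exists (succ R (proj x), inv_symbol R, x.2).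
by rewrite /edge /label /= !eqxx; case: ifP => // _; apply: succP.
Qed.

(** At a source the two values of the bit over one successor are enough; away
    from the sources the sink reached is determined by label, bit and point. *)
Lemma card_edge R x :
  if label x == R then 1 < #|[set y | edge R x y]|
  else #|[set y | edge R x y]| == 1.
Proof.
case: x => [[a Q] k]; rewrite /label /=; case: eqP => [->|/eqP QR].
  pose y l : labelled := (succ R a, inv_symbol R, l).
  have y2 : #|[set y true; y false]| = 2 by rewrite cards2 /y xpair_eqE andbF.
  rewrite -y2; apply/subset_leq_card/subsetP => z.
  by rewrite !inE => /orP[] /eqP->; rewrite edge_lift succP.
apply/cards1P; exists (succ R a, inv_symbol R, k).
apply/setP => -[[b S] l]; rewrite !inE /edge /label /proj /= (negbTE QR).
by rewrite !xpair_eqE; do 3!case: (_ == _).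
Qed.

Lemma outgoing_edge R x : outgoing (edge R) x = (label x == R).
Proof.
have preds : [set y | edge R y x] = [set y | edge (inv_symbol R) x y].
  by apply/setP => y; rewrite !inE edge_inv.
rewrite /outgoing preds.
have := card_edge R x; have := card_edge (inv_symbol R) x.
case: (label x =P R) => [->|_]; first by rewrite inv_symbol_neq => -> ->.
by move=> _ /eqP->.
Qed.

End Labelling.

Section LabelledStructure.

Set Implicit Arguments.
Unset Strict Implicit.

Variables (m : nat) (hm : 0 < m) (A : F0 m).

Lemma labelled_gt0 : 0 < #|labelled A|.
Proof.
case/card_gt0P: (carrier_gt0 A) => a _.
by apply/card_gt0P; exists (a, (Ordinal hm, false), false).
Qed.

Lemma edge_surjective (i : 'I_m) : surjective_rel (@edge m A (i, false)).
Proof.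
move=> x; split; first exact: edge_serial.
have [y xy] := edge_serial (inv_symbol (i, false)) x.
by exists y; rewrite -edge_inv.
Qed.

Definition labelled_structure : F0 m := MkF0 labelled_gt0 edge_surjective.

Lemma interp_labelled R (x y : labelled_structure) :
  interp R x y = edge R x y.
Proof.
case: R => i [] //.
by rewrite -[(i, true)]/(inv_symbol (i, false)) edge_inv.
Qed.

Lemma outgoing_labelled R (x : labelled_structure) :
  outgoing (interp R) x = (label x == R).
Proof.
rewrite -outgoing_edge; apply: (@eq_outgoing (labelled A)).
exact: interp_labelled.
Qed.

End LabelledStructure.

Theorem theorem4p6 (m : nat) (hm : 1 <= m) :
  coinitial (fun B : F0 m =>
    outgoing_for_exactly_one B /\ edges_outgoing_or_incoming B).
Proof.
move=> A; exists (labelled_structure hm A); split; first split.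
- move=> x; exists (label x); split; first by rewrite outgoing_labelled.
  by move=> R; rewrite outgoing_labelled => /eqP.
- move=> i x y /edge_label xy.
  (* Being incoming for [s_i] is by definition being outgoing for [s_i^-1]. *)
  rewrite -[outgoing _ x]/(outgoing (interp (i, false)) x).
  rewrite -[incoming _ y]/(outgoing (interp (i, true)) y) !outgoing_labelled.
  by case: xy => ->; [left | right].
- exists (@proj m A); split=> [a|i a b].
    by exists (a, (Ordinal hm, false), false).
  split=> [ab|[x [y [<- <- /edge_proj]]] //].
  exists (a, (i, false), false), (b, (i, true), false); split=> //.
  by rewrite /= (edge_lift (i, false)).
Qed.
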